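(* Let $\mathbb{K}$ be an algebraically closed field of characteristic different from $2$, let $D_\infty=\langle a,b \mid a^2=b^2=1\rangle$ be the infinite dihedral group, and let $R=\mathbb{K}D_\infty$ be its group algebra. Put $e=\frac{1-a}{2}$ and $e'=\frac{1-b}{2}$. Then there are precisely four conjugacy classes of primitive idempotents in $R$, namely the classes represented by $e,\ 1-e,\ e',\ 1-e'$.
   Context: Two elements $r,r'\in R$ are conjugate if $r'=\nu^{-1}r\nu$ for some unit $\nu\in R^\times$. An idempotent $x\in R$ is primitive if $x\neq 0$ and $x$ cannot be written as a sum $x=x_1+x_2$ of two nonzero idempotents with $x_1x_2=x_2x_1=0$ (equivalently, the right module $xR$ is indecomposable). *)

(* Defs.v *)
From HB Require Import structures.
From mathcomp Require Import all_boot all_order all_algebra.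
From mathcomp Require Import finmap.
From mathcomp Require Import monalg.

Set Implicit Arguments.
Unset Strict Implicit.
Unset Printing Implicit Defensive.

Import GRing.Theory.

Local Open Scope fset_scope.
Local Open Scope ring_scope.

(* The group algebra R[G]: finitely supported functions G -> R with the       *)
(* convolution product.  [malg] supplies the free R-module on G; its own ring *)
(* structure requires a monoid in which only 1 is invertible, so the product  *)
(* is defined again here, for an arbitrary group.                             *)
Definition group_algebra (R : comNzRingType) (G : groupType) : Type :=
  {malg R[G]}.

HB.instance Definition _ R G :=
  GRing.Lmodule.copy (group_algebra R G) {malg R[G]}.

Section GroupAlgebra.
Variables (R : comNzRingType) (G : groupType).
Local Notation RG := (group_algebra R G).
Implicit Types (x y z : RG) (g h : G) (c d : R).

Definition galg_elt g : RG := << 1 *g g >>.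

Definition galg_one : RG := galg_elt 1%g.

Definition galg_mul x y : RG :=
  \sum_(g <- msupp x) \sum_(h <- msupp y) << x@_g * y@_h *g (g * h)%g >>.

Lemma galg_mulw (A B : {fset G}) x y :
    msupp x `<=` A -> msupp y `<=` B ->
  galg_mul x y = \sum_(g <- A) \sum_(h <- B) << x@_g * y@_h *g (g * h)%g >>.
Proof.
move=> sA sB; rewrite /galg_mul (big_fset_incl _ sA) /=.
  apply/eq_bigr=> g _; apply/big_fset_incl => // h _ /mcoeff_outdom ->.
  by rewrite mulr0 monalgU0.
move=> g _ /mcoeff_outdom xg.
by rewrite big1 => // h _; rewrite xg mul0r monalgU0.
Qed.

Lemma galg_mulDl : left_distributive galg_mul +%R.
Proof.
move=> x y z.
rewrite (@galg_mulw (msupp x `|` msupp y) (msupp z) (x + y) z) ?msuppD_le //.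
rewrite (@galg_mulw (msupp x `|` msupp y) (msupp z) x z) ?fsubsetUl //.
rewrite (@galg_mulw (msupp x `|` msupp y) (msupp z) y z) ?fsubsetUr //.
rewrite -big_split /=; apply/eq_bigr=> g _.
rewrite -big_split /=; apply/eq_bigr=> h _.
by rewrite mcoeffD mulrDl monalgUD.
Qed.

Lemma galg_mulDr : right_distributive galg_mul +%R.
Proof.
move=> x y z.
rewrite (@galg_mulw (msupp x) (msupp y `|` msupp z) x (y + z)) ?msuppD_le //.
rewrite (@galg_mulw (msupp x) (msupp y `|` msupp z) x y) ?fsubsetUl //.
rewrite (@galg_mulw (msupp x) (msupp y `|` msupp z) x z) ?fsubsetUr //.
rewrite -big_split /=; apply/eq_bigr=> g _.
rewrite -big_split /=; apply/eq_bigr=> h _.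
by rewrite mcoeffD mulrDr monalgUD.
Qed.

Lemma galg_mulUU c d g h :
  galg_mul << c *g g >> << d *g h >> = << c * d *g (g * h)%g >>.
Proof.
by rewrite (galg_mulw msuppU_le msuppU_le) !big_seq_fset1 !mcoeffUU.
Qed.

Lemma galg_mul0l : left_zero 0 galg_mul.
Proof. by move=> x; rewrite /galg_mul msupp0 big_seq_fset0. Qed.

Lemma galg_mul0r : right_zero 0 galg_mul.
Proof.
by move=> x; rewrite /galg_mul big1 // => g _; rewrite msupp0 big_seq_fset0.
Qed.

Lemma galg_mul_suml I (s : seq I) (F : I -> RG) y :
  galg_mul (\sum_(i <- s) F i) y = \sum_(i <- s) galg_mul (F i) y.
Proof.
exact: (big_morph (galg_mul^~ y) (fun a b => galg_mulDl a b y) (galg_mul0l y)).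
Qed.

Lemma galg_mul_sumr I (s : seq I) (F : I -> RG) x :
  galg_mul x (\sum_(i <- s) F i) = \sum_(i <- s) galg_mul x (F i).
Proof. exact: (big_morph (galg_mul x) (galg_mulDr x) (galg_mul0r x)). Qed.

Lemma galg_ind (P : RG -> Prop) :
    P 0 -> (forall x y, P x -> P y -> P (x + y)) ->
    (forall c g, P << c *g g >>) ->
  forall x, P x.
Proof. by move=> P0 PD PU x; rewrite [x]monalgE; elim/big_ind: _. Qed.

Lemma galg_mulA : associative galg_mul.
Proof.
move=> x y z; elim/galg_ind: x => [|x1 x2 e1 e2|c g].
- by rewrite !galg_mul0l.
- by rewrite !galg_mulDl e1 e2.
elim/galg_ind: y => [|y1 y2 e1 e2|d h].
- by rewrite !(galg_mul0l, galg_mul0r).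
- by rewrite !(galg_mulDl, galg_mulDr) e1 e2.
elim/galg_ind: z => [|z1 z2 e1 e2|b k].
- by rewrite !galg_mul0r.
- by rewrite !galg_mulDr e1 e2.
by rewrite !galg_mulUU mulrA mulgA.
Qed.

Lemma galg_mul1l : left_id galg_one galg_mul.
Proof.
elim/galg_ind=> [|x y ex ey|c g]; first exact: galg_mul0r.
  by rewrite galg_mulDr ex ey.
by rewrite galg_mulUU mul1r mul1g.
Qed.

Lemma galg_mul1r : right_id galg_one galg_mul.
Proof.
elim/galg_ind=> [|x y ex ey|c g]; first exact: galg_mul0l.
  by rewrite galg_mulDl ex ey.
by rewrite galg_mulUU mulr1 mulg1.
Qed.

Lemma galg_one_neq0 : galg_one != 0.
Proof. by rewrite monalgU_eq0 oner_eq0. Qed.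

HB.instance Definition _ := GRing.Zmodule_isNzRing.Build (group_algebra R G)
  galg_mulA galg_mul1l galg_mul1r galg_mulDl galg_mulDr galg_one_neq0.

Lemma galg_scaleU b c g : b *: (<< c *g g >> : RG) = << b * c *g g >>.
Proof. by apply/malgP=> h; rewrite mcoeffZ !mcoeffU mulrnAr. Qed.

Lemma galg_scaleAl c x y : c *: (x * y) = (c *: x) * y.
Proof.
elim/galg_ind: x => [|x1 x2 e1 e2|d g]; first by rewrite !(mul0r, scaler0).
  by rewrite !(mulrDl, scalerDr) e1 e2.
elim/galg_ind: y => [|y1 y2 e1 e2|b h]; first by rewrite !(mulr0, scaler0).
  by rewrite !(mulrDr, scalerDr) e1 e2.
by rewrite /GRing.mul /= !(galg_mulUU, galg_scaleU) mulrA.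
Qed.

HB.instance Definition _ :=
  GRing.Lmodule_isLalgebra.Build R (group_algebra R G) galg_scaleAl.

Lemma galg_scaleAr c x y : c *: (x * y) = x * (c *: y).
Proof.
elim/galg_ind: x => [|x1 x2 e1 e2|d g]; first by rewrite !(mul0r, scaler0).
  by rewrite !(mulrDl, scalerDr) e1 e2.
elim/galg_ind: y => [|y1 y2 e1 e2|b h]; first by rewrite !(mulr0, scaler0).
  by rewrite !(mulrDr, scalerDr) e1 e2.
by rewrite /GRing.mul /= !(galg_mulUU, galg_scaleU) mulrCA.
Qed.

HB.instance Definition _ :=
  GRing.Lalgebra_isAlgebra.Build R (group_algebra R G) galg_scaleAr.

Lemma galg_elt1 : galg_elt 1%g = 1.
Proof. by []. Qed.

Lemma galg_eltM g h : galg_elt (g * h)%g = galg_elt g * galg_elt h.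
Proof. by rewrite [RHS]galg_mulUU mulr1. Qed.

Lemma galgE x : x = \sum_(g <- msupp x) x@_g *: galg_elt g.
Proof.
by rewrite [LHS]monalgE; apply: eq_bigr => g _; rewrite galg_scaleU mulr1.
Qed.

End GroupAlgebra.

Arguments galg_elt R {G} g.

(* The group <a, b | a^2 = b^2 = 1>, given by its normal forms: words in the  *)
(* letters a = true and b = false without two equal consecutive letters.      *)
(* [Dinf_presentation] is the universal property of the presentation.         *)
Definition reduced : pred (seq bool) := sorted (fun x y => x != y).

Record Dinf : Type := MkDinf { word :> seq bool; _ : reduced word }.

HB.instance Definition _ := [isSub for word].
HB.instance Definition _ := [Choice of Dinf by <:].

Definition cons_red (x : bool) (w : seq bool) : seq bool :=
  if w is y :: w' then if x == y then w' else x :: w else [:: x].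

Definition mul_word (u v : seq bool) : seq bool := foldr cons_red v u.

Lemma cons_red_reduced x w : reduced w -> reduced (cons_red x w).
Proof.
case: w => [|y w] //= rw.
case: ifP => [_|/negbT nxy]; first exact: path_sorted rw.
by rewrite /reduced /= nxy.
Qed.

Lemma mul_word_reduced u v : reduced v -> reduced (mul_word u v).
Proof. by move=> rv; elim: u => //= x u; apply: cons_red_reduced. Qed.

Lemma cons_redK x w : reduced w -> cons_red x (cons_red x w) = w.
Proof.
case: w => [|y w] /=; first by rewrite eqxx.
case: (eqVneq x y) => [<-|nxy] rw; last by rewrite /= eqxx.
by case: w rw => [|z w] //= /andP[/negbTE->].
Qed.

Lemma mul_word_cons_red x u v :
  reduced v -> mul_word (cons_red x u) v = cons_red x (mul_word u v).
Proof.
move=> rv; case: u => [|y u] //=; case: (eqVneq x y) => [<-|] //=.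
by rewrite cons_redK // mul_word_reduced.
Qed.

Lemma mul_wordA u v w :
  reduced w -> mul_word u (mul_word v w) = mul_word (mul_word u v) w.
Proof. by move=> rw; elim: u => //= x u ->; rewrite mul_word_cons_red. Qed.

Lemma mul_word0 w : reduced w -> mul_word w [::] = w.
Proof.
rewrite /reduced; elim: w => //= x [|y w] //= IHw /andP[nxy /IHw ->] /=.
by rewrite (negbTE nxy).
Qed.

Lemma rev_reduced w : reduced w -> reduced (rev w).
Proof.
by rewrite /reduced rev_sorted; apply: sub_sorted => x y; rewrite eq_sym.
Qed.

Lemma mul_wordV w : mul_word (rev w) w = [::].
Proof.
by elim: w => //= x w IHw; rewrite rev_cons /mul_word foldr_rcons /= eqxx.
Qed.

Definition Dinf_one : Dinf := @MkDinf [::] isT.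
Definition Dinf_mul (u v : Dinf) : Dinf :=
  MkDinf (mul_word_reduced u (valP v)).
Definition Dinf_inv (u : Dinf) : Dinf := MkDinf (rev_reduced (valP u)).

Lemma Dinf_mulA : associative Dinf_mul.
Proof. by move=> u v w; apply/val_inj/mul_wordA/valP. Qed.

Lemma Dinf_mul1 : left_id Dinf_one Dinf_mul.
Proof. by move=> u; apply/val_inj. Qed.

Lemma Dinf_mulr1 : right_id Dinf_one Dinf_mul.
Proof. by move=> u; apply/val_inj/mul_word0/valP. Qed.

Lemma Dinf_mulV : left_inverse Dinf_one Dinf_inv Dinf_mul.
Proof. by move=> u; apply/val_inj/mul_wordV. Qed.

Lemma Dinf_mulrV : right_inverse Dinf_one Dinf_inv Dinf_mul.
Proof.
by move=> u; apply/val_inj; rewrite /= -{1}[word u]revK mul_wordV.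
Qed.

HB.instance Definition _ := isGroup.Build Dinf
  Dinf_mulA Dinf_mul1 Dinf_mulr1 Dinf_mulV Dinf_mulrV.

Definition Da : Dinf := @MkDinf [:: true] isT.
Definition Db : Dinf := @MkDinf [:: false] isT.

Lemma Dinf_presentation :
  [/\ (Da * Da = 1)%g, (Db * Db = 1)%g &
    forall (G : groupType) (s t : G), (s * s = 1)%g -> (t * t = 1)%g ->
      exists f : Dinf -> G,
        [/\ {morph f : u v / (u * v)%g}, f Da = s, f Db = t &
          forall f' : Dinf -> G, {morph f' : u v / (u * v)%g} ->
            f' Da = s -> f' Db = t -> f' =1 f]].
Proof.
split; [exact/val_inj | exact/val_inj | move=> G s t ss tt].
pose l (x : bool) := if x then s else t.
have ll x : (l x * l x = 1)%g by case: x.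
pose p (w : seq bool) := foldr (fun x g => (l x * g)%g) 1%g w.
have p_cons x w : p (cons_red x w) = (l x * p w)%g.
  case: w => [|y w] //=; case: eqVneq => //= <-.
  by rewrite mulgA ll mul1g.
exists (fun u => p u); split=> [u v|||f' f'M f'a f'b].
- rewrite /=; elim: (word u) => [|x w IHw]; first by rewrite mul1g.
  by rewrite [mul_word _ _]/= p_cons IHw mulgA.
- exact: mulg1.
- exact: mulg1.
case=> w; elim: w => [|x w IHw] rw.
  have /(congr1 (fun g => g * (f' 1)^-1)%g) := f'M 1%g 1%g.
  rewrite mul1g mulgK mulgV => f'1.
  by rewrite [RHS]f'1; congr f'; apply/val_inj.
have rw' : reduced w by apply: path_sorted rw.
rewrite /= -[p w](IHw rw').
have ->: MkDinf rw = ((if x then Da else Db) * MkDinf rw')%g.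
  apply/val_inj; rewrite /=; case: x rw => /=;
    by case: (w) => [|y w'] //= /andP[/negbTE->].
by rewrite f'M; case: (x); rewrite ?f'a ?f'b.
Qed.

Section Idempotents.
Variable R : nzRingType.
Implicit Types r x : R.

Definition is_idempotent x : Prop := x * x = x.

Definition primitive_idempotent x : Prop :=
  [/\ is_idempotent x, x != 0 &
    ~ exists x1 x2 : R,
        [/\ is_idempotent x1 /\ is_idempotent x2, x1 != 0 /\ x2 != 0,
            x = x1 + x2, x1 * x2 = 0 & x2 * x1 = 0]].

Definition conjugate r r' : Prop :=
  exists nu nu' : R, [/\ nu * nu' = 1, nu' * nu = 1 & r' = nu' * r * nu].

End Idempotents.

(* Main.v *)
(* With [c = (ab + ba)/2], which is central, sending [a] to [diag(1, -1)] and
   [b] to [[c, 1 - c], [1 + c, -c]] embeds the group algebra into [M_2(K[c])];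
   the image is the order of matrices [M] with [M_01(1) = 0] and [M_10(-1) = 0].
   An idempotent other than 0 and 1 has trace 1 there, so these are the
   primitive ones.  Since [K[c]] is a PID, such a matrix factors as a column
   times a row, and the resulting bases conjugate any two of them.  The
   conjugating matrix lies in the order as soon as the upper left entries of the
   two idempotents agree at 1 and at -1; these entries are 0 or 1 and invariant
   under conjugation, whence four classes. *)
From HB Require Import structures.
Require Import Defs.
From mathcomp Require Import all_boot all_order all_algebra.
From mathcomp Require Import finmap monalg ring.

Set Implicit Arguments.
Unset Strict Implicit.
Unset Printing Implicit Defensive.

Import GRing.Theory.
Local Open Scope ring_scope.

(** * Linear extension of a group representation to the group algebra *)

Section Lift.
Variables (R : comNzRingType) (G : groupType) (S : comNzRingType).
Variables (A : algType S) (f : {rmorphism R -> S}) (rho : G -> A).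

(** Scalars are carried along [f] because the target will be an algebra of matrices over [{poly F}],
    on which [F] acts through constant polynomials. *)
Definition galg_lift (x : group_algebra R G) : A :=
  \sum_(g <- msupp x) f x@_g *: rho g.

Lemma galg_liftw (B : {fset G}) (x : group_algebra R G) :
  (msupp x `<=` B)%fset -> galg_lift x = \sum_(g <- B) f x@_g *: rho g.
Proof.
move=> sB; rewrite /galg_lift (big_fset_incl _ sB) //= => g _ /mcoeff_outdom ->.
by rewrite rmorph0 scale0r.
Qed.

Lemma galg_liftU c g : galg_lift << c *g g >> = f c *: rho g.
Proof. by rewrite (galg_liftw msuppU_le) big_seq_fset1 mcoeffUU. Qed.

Lemma galg_liftD (x y : group_algebra R G) :
  galg_lift (x + y) = galg_lift x + galg_lift y.
Proof.
pose B := (msupp x `|` msupp y)%fset.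
rewrite !(@galg_liftw B) ?fsubsetUl ?fsubsetUr ?msuppD_le //.
rewrite -big_split; apply: eq_bigr => g _.
by rewrite mcoeffD rmorphD scalerDl.
Qed.

Lemma galg_lift0 : galg_lift 0 = 0.
Proof. by rewrite /galg_lift msupp0 big_seq_fset0. Qed.

Lemma galg_liftZ c (x : group_algebra R G) :
  galg_lift (c *: x) = f c *: galg_lift x.
Proof.
elim/galg_ind: x => [|x y ex ey|d g].
- by rewrite !(scaler0, galg_lift0).
- by rewrite !(scalerDr, galg_liftD) ex ey.
by rewrite galg_scaleU !galg_liftU rmorphM scalerA.
Qed.

Hypothesis rho1 : rho 1%g = 1.
Hypothesis rhoM : forall g h, rho (g * h)%g = rho g * rho h.

Lemma galg_lift1 : galg_lift 1 = 1.
Proof. by rewrite galg_liftU rmorph1 scale1r. Qed.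

Lemma galg_liftM (x y : group_algebra R G) :
  galg_lift (x * y) = galg_lift x * galg_lift y.
Proof.
elim/galg_ind: x => [|x1 x2 e1 e2|c g].
- by rewrite !(mul0r, galg_lift0).
- by rewrite !(mulrDl, galg_liftD) e1 e2.
elim/galg_ind: y => [|y1 y2 e1 e2|d h].
- by rewrite !(mulr0, galg_lift0).
- by rewrite !(mulrDr, galg_liftD) e1 e2.
rewrite [_ * _]galg_mulUU !galg_liftU rmorphM rhoM.
by rewrite -scalerAl -scalerAr scalerA.
Qed.

End Lift.

(** * Two-by-two matrices given by their entries *)

Section Matrix2.
Variable R : comNzRingType.
Implicit Types p q r s : R.

Definition mx2 p q r s : 'M[R]_2 :=
  \matrix_(i, j) if i == 0 then if j == 0 then p else q
                 else if j == 0 then r else s.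

Lemma mx2E (M : 'M[R]_2) : M = mx2 (M 0 0) (M 0 1) (M 1 0) (M 1 1).
Proof.
apply/matrixP=> i j; rewrite mxE.
by case: i j => [[|[|//]] ?] [[|[|//]] ?] /=; congr (M _ _); apply/val_inj.
Qed.

Lemma mx2_inj p q r s p' q' r' s' :
  mx2 p q r s = mx2 p' q' r' s' -> [/\ p = p', q = q', r = r' & s = s'].
Proof.
move/matrixP=> e; split.
- by have := e 0 0; rewrite !mxE.
- by have := e 0 1; rewrite !mxE.
- by have := e 1 0; rewrite !mxE.
- by have := e 1 1; rewrite !mxE.
Qed.

Lemma mx2D p q r s p' q' r' s' :
  mx2 p q r s + mx2 p' q' r' s' = mx2 (p + p') (q + q') (r + r') (s + s').
Proof. by apply/matrixP=> i j; rewrite !mxE; do 2 case: ifP. Qed.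

Lemma mx2Z c p q r s :
  c *: mx2 p q r s = mx2 (c * p) (c * q) (c * r) (c * s).
Proof. by apply/matrixP=> i j; rewrite !mxE; do 2 case: ifP. Qed.

Lemma mx2M p q r s p' q' r' s' :
  mx2 p q r s * mx2 p' q' r' s' =
  mx2 (p * p' + q * r') (p * q' + q * s') (r * p' + s * r') (r * q' + s * s').
Proof.
apply/matrixP=> i j; rewrite !mxE !big_ord_recl big_ord0 !mxE /= addr0.
by do 2 case: ifP.
Qed.

Lemma mx2_1 : 1 = mx2 1 0 0 1.
Proof. by rewrite [LHS]mx2E !mxE. Qed.

Lemma mx2_scalar p : p%:M = mx2 p 0 0 p.
Proof. by rewrite [LHS]mx2E !mxE. Qed.

Lemma mx2_0 : 0 = mx2 0 0 0 0.
Proof. by rewrite [LHS]mx2E !mxE. Qed.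

End Matrix2.

(** * Idempotents of a domain and of its two-by-two matrices *)

Lemma idempotent_01 (D : idomainType) (t : D) :
  is_idempotent t -> t = 0 \/ t = 1.
Proof.
move=> tt; have /eqP : t * (t - 1) = 0 by rewrite mulrBr tt mulr1 subrr.
by rewrite mulf_eq0 subr_eq0 => /orP[]/eqP; [left | right].
Qed.

Lemma compl_idem (A : nzRingType) (x : A) :
  is_idempotent x -> is_idempotent (1 - x).
Proof.
rewrite /is_idempotent => ix.
by rewrite mulrBr mulrBl mulr1 mul1r mulrBl mul1r ix subrr subr0.
Qed.

Section IdempotentMatrices.
Variable D : idomainType.
Implicit Types p q r s : D.

(** The off-diagonal entries of [M * M = M] read [q * (p + s - 1) = 0] and [r * (p + s - 1) = 0]. A
    trace other than 1 thus makes the matrix diagonal, with idempotents of a domain on the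
    diagonal. *)
Lemma mx2_idem p q r s :
  is_idempotent (mx2 p q r s) ->
  [\/ mx2 p q r s = 0, mx2 p q r s = 1 | p + s = 1].
Proof.
rewrite /is_idempotent mx2M => /mx2_inj[ep eq er es].
have [ps|nps] := eqVneq (p + s) 1; first by constructor 3.
have nz : p + s - 1 != 0 by rewrite subr_eq0.
have q0 : q = 0.
  apply/(mulIf nz); rewrite mul0r mulrBr mulr1 -[X in _ - X]eq; ring.
have r0 : r = 0.
  apply/(mulIf nz); rewrite mul0r mulrBr mulr1 -[X in _ - X]er; ring.
rewrite q0 r0 !(mul0r, mulr0, addr0, add0r) in ep es *.
have [p0|p1] := idempotent_01 ep; have [s0|s1] := idempotent_01 es.
- by constructor 1; rewrite p0 s0 mx2_0.
- by constructor 3; rewrite p0 s1 add0r.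
- by constructor 3; rewrite p1 s0 addr0.
- by constructor 2; rewrite p1 s1 mx2_1.
Qed.

Lemma mx2_idem_det p q r s :
  is_idempotent (mx2 p q r s) -> p + s = 1 -> p * s = q * r.
Proof.
rewrite /is_idempotent mx2M => /mx2_inj[ep _ _ _] ps.
have ->: s = 1 - p by rewrite -ps addrC addKr.
by rewrite mulrBr mulr1 -{1}ep; ring.
Qed.

End IdempotentMatrices.

(** Dividing the first row by its gcd leaves a row [(v1, v2)] of coprime entries. Determinant 0
    makes the second row proportional to it, and the Bezout relation [x * v1 + y * v2 = 1] yields
    the factor [x * r + y * s]. *)
Lemma rank1_factor (F : fieldType) (p q r s : {poly F}) :
  p + s = 1 -> p * s = q * r ->
  exists u1 u2 v1 v2 : {poly F},
    [/\ p = u1 * v1, q = u1 * v2, r = u2 * v1 & s = u2 * v2].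
Proof.
(* A zero first row has gcd 0. The trace then gives [s = 1], and the second row itself serves as
   [(v1, v2)]. *)
move=> ps dt; have [/andP[/eqP p0 /eqP q0]|nz] := boolP ((p == 0) && (q == 0)).
  exists 0, 1, r, 1; rewrite p0 q0 !mul0r !mul1r; split=> //.
  by rewrite -ps p0 add0r.
rewrite negb_and in nz.
have /Bezout_eq1_coprimepP[[x y] /= bz] := coprimep_div_gcd nz.
set g := gcdp p q in bz *.
have gnz : g != 0 by rewrite gcdp_eq0 negb_and.
have pE : p = g * (p %/ g) by rewrite mulrC divpK ?dvdp_gcdl.
have qE : q = g * (q %/ g) by rewrite mulrC divpK ?dvdp_gcdr.
set v1 := p %/ g in bz pE; set v2 := q %/ g in bz qE.
have e : v1 * s = v2 * r by apply: (mulfI gnz); rewrite !mulrA -pE -qE.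
exists g, (x * r + y * s), v1, v2; split=> //.
- by rewrite mulrDl -[in RHS](mulrA y) [s * v1]mulrC e -[LHS]mul1r -bz; ring.
- by rewrite mulrDl -[in RHS](mulrA x) [r * v2]mulrC -e -[LHS]mul1r -bz; ring.
Qed.

(** * The order of matrices triangular at 1 and at -1, and conjugation in it *)

Section Order.
Variable F : fieldType.

(** Such a matrix is lower triangular at 1 and upper triangular at -1, so evaluating its upper left
    entry at either point is multiplicative. *)
Definition in_order (M : 'M[{poly F}]_2) : Prop :=
  (M 0 1).[1] = 0 /\ (M 1 0).[-1] = 0.

(** At 1 and at -1 the upper left entry is multiplicative with values in a commutative field, so the
    contributions of [P] and [Q] cancel. *)
Lemma in_order_conj_diag (x y P Q : 'M[{poly F}]_2) :
    in_order P -> in_order Q -> in_order x -> P * Q = 1 -> y = Q * x * P ->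
  (y 0 0).[1] = (x 0 0).[1] /\ (y 0 0).[-1] = (x 0 0).[-1].
Proof.
rewrite /in_order (mx2E P) (mx2E Q) (mx2E x) !mxE /=.
move: (P 0 0) (P 0 1) (P 1 0) (P 1 1) => p1 p2 p3 p4.
move: (Q 0 0) (Q 0 1) (Q 1 0) (Q 1 1) => q1 q2 q3 q4.
move: (x 0 0) (x 0 1) (x 1 0) (x 1 1) => x1 x2 x3 x4.
move=> [hp2 hp3] [hq2 hq3] [hx2 hx3].
rewrite mx2_1 mx2M => /mx2_inj[e _ _ _] ->; rewrite !mx2M !mxE /=.
rewrite !hornerE hp3 hq2 hx2 hx3 !(mulr0, mul0r, addr0).
have e1 : p1.[1] * q1.[1] = 1.
  by have := congr1 (horner^~ 1) e; rewrite /= !hornerE hp2 mul0r addr0.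
have e2 : p1.[-1] * q1.[-1] = 1.
  by have := congr1 (horner^~ (-1)) e; rewrite /= !hornerE hq3 mulr0 addr0.
by split; rewrite mulrAC [_ * p1.[_]]mulrC ?e1 ?e2 mul1r.
Qed.

Lemma rank1_conj (x y : 'M[{poly F}]_2) :
    is_idempotent x -> x 0 0 + x 1 1 = 1 -> in_order x ->
    is_idempotent y -> y 0 0 + y 1 1 = 1 -> in_order y ->
    (x 0 0).[1] = (y 0 0).[1] -> (x 0 0).[-1] = (y 0 0).[-1] ->
  exists P Q : 'M[{poly F}]_2,
    [/\ in_order P /\ in_order Q, P * Q = 1, Q * P = 1 & y = Q * x * P].
Proof.
rewrite /in_order (mx2E x) (mx2E y) !mxE /=.
move: (x 0 0) (x 0 1) (x 1 0) (x 1 1) => x1 x2 x3 x4.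
move: (y 0 0) (y 0 1) (y 1 0) (y 1 1) => y1 y2 y3 y4.
move=> ix tx; have dx := mx2_idem_det ix tx.
move=> ox iy ty; have dy := mx2_idem_det iy ty.
move: ox => [ox2 ox3] [oy2 oy3].
have [u1 [u2 [v1 [v2 [Ex1 Ex2 Ex3 Ex4]]]]] := rank1_factor tx dx.
have [w1 [w2 [z1 [z2 [Ey1 Ey2 Ey3 Ey4]]]]] := rank1_factor ty dy.
move: tx ty ox2 ox3 oy2 oy3; rewrite {ix dx iy dy}.
rewrite {}Ex1 {}Ex2 {}Ex3 {}Ex4 {}Ey1 {}Ey2 {}Ey3 {}Ey4.
move=> tx ty; rewrite !hornerE => ox2 ox3 oy2 oy3 h1 h2.
(* [Q] and [P] are [[w1, -z2], [w2, z1]] * [[v1, v2], [-u2, u1]] and its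
   adjugate: each of these two factors has determinant 1 and diagonalises one
   of the idempotents. *)
pose q1 := w1 * v1 + z2 * u2; pose q2 := w1 * v2 - z2 * u1.
pose q3 := w2 * v1 - z1 * u2; pose q4 := w2 * v2 + z1 * u1.
have dQ : q1 * q4 - q2 * q3 = 1.
  transitivity ((u1 * v1 + u2 * v2) * (w1 * z1 + w2 * z2)).
    by rewrite /q1 /q2 /q3 /q4; ring.
  by rewrite tx ty mulr1.
have t c : u1.[c] * v1.[c] + u2.[c] * v2.[c] = 1.
  by have := congr1 (horner^~ c) tx; rewrite /= !hornerE.
have t' c : w1.[c] * z1.[c] + w2.[c] * z2.[c] = 1.
  by have := congr1 (horner^~ c) ty; rewrite /= !hornerE.
(* Stated over the field to serve twice: at 1 it kills [q2], and at -1, with the indices 1 and 2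
   exchanged, it kills [q3]. Multiplying the goal by [a1 * b1 + a2 * b2 = 1] produces only terms
   divisible by [a1 * b2] or, after replacing one diagonal by the other, by [c1 * d2]. *)
have cross (a1 a2 b1 b2 c1 c2 d1 d2 : F) :
    a1 * b1 + a2 * b2 = 1 -> c1 * d1 + c2 * d2 = 1 -> a1 * b1 = c1 * d1 ->
    a1 * b2 = 0 -> c1 * d2 = 0 -> c1 * b2 - d2 * a1 = 0.
  move=> ta tc e ab cd.
  have e2 : a2 * b2 = c2 * d2 by apply: (addrI (a1 * b1)); rewrite ta e tc.
  rewrite -[LHS]mul1r -ta.
  transitivity ((a1 * b2) * (b1 * c1 - a2 * d2) + a2 * b2 * (c1 * b2)
                - a1 * b1 * (d2 * a1)); first ring.
  rewrite ab mul0r add0r e e2.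
  transitivity ((c1 * d2) * (c2 * b2 - d1 * a1)); first ring.
  by rewrite cd mul0r.
have hq2 : q2.[1] = 0.
  by rewrite /q2 !hornerE (cross _ _ _ _ _ _ _ _ (t 1) (t' 1)).
have hq3 : q3.[-1] = 0.
  have h3 : u2.[-1] * v2.[-1] = w2.[-1] * z2.[-1].
    by apply: (addrI (u1.[-1] * v1.[-1])); rewrite t h2 t'.
  have := t' (-1); have := t (-1); rewrite addrC => t1; rewrite addrC => t1'.
  by rewrite /q3 !hornerE (cross _ _ _ _ _ _ _ _ t1 t1').
exists (mx2 q4 (- q2) (- q3) q1), (mx2 q1 q2 q3 q4); rewrite !mxE /= !hornerN.
rewrite hq2 hq3 oppr0; split=> //.
- by rewrite mx2M mx2_1 -dQ; congr mx2; ring.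
- by rewrite mx2M mx2_1 -dQ; congr mx2; ring.
(* Up to the factor [u1 * v1 + u2 * v2 = 1], [Q] sends the column [u] to [w], and then [P] sends the
   row [v] to [z]. *)
have -> : mx2 q1 q2 q3 q4 * mx2 (u1 * v1) (u1 * v2) (u2 * v1) (u2 * v2) =
    (u1 * v1 + u2 * v2) *: mx2 (w1 * v1) (w1 * v2) (w2 * v1) (w2 * v2).
  by rewrite mx2M mx2Z; congr mx2; rewrite /q1 /q2 /q3 /q4; ring.
have vP :
    mx2 (w1 * v1) (w1 * v2) (w2 * v1) (w2 * v2) * mx2 q4 (- q2) (- q3) q1 =
    (u1 * v1 + u2 * v2) *: mx2 (w1 * z1) (w1 * z2) (w2 * z1) (w2 * z2).
  by rewrite mx2M mx2Z; congr mx2; rewrite /q1 /q2 /q3 /q4; ring.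
by rewrite tx !scale1r in vP *.
Qed.

End Order.

(** * Algebras generated by two involutions, over the polynomials in [c] *)

Section TwoInvolutions.
Variables (F : fieldType) (A : algType F) (a b : A).
Hypotheses (two_neq0 : 2%:R != 0 :> F) (aa : a * a = 1) (bb : b * b = 1).

Definition half_sum : A := 2^-1 *: (a * b + b * a).
Local Notation c := half_sum.

(** Conjugation by [a] exchanges [a * b] and [b * a]. *)
Lemma comm_ca : c * a = a * c.
Proof.
rewrite /half_sum -scalerAl -scalerAr mulrDl mulrDr -!mulrA aa !mulrA aa.
by rewrite mul1r mulr1 addrC.
Qed.

Lemma comm_cb : c * b = b * c.
Proof.
rewrite /half_sum -scalerAl -scalerAr mulrDl mulrDr -!mulrA bb !mulrA bb.
by rewrite mul1r mulr1 addrC.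
Qed.

Lemma comm_horner (x : A) (p : {poly F}) :
  c * x = x * c -> horner_alg c p * x = x * horner_alg c p.
Proof.
move=> cx; elim/poly_ind: p => [|p k IHp]; first by rewrite rmorph0 mul0r mulr0.
rewrite rmorphD rmorphM /= horner_algX horner_algC mulrDl mulrDr.
by rewrite -mulrA cx !mulrA IHp mulr_algl mulr_algr.
Qed.

(** Combinations of [1, a, b, a * b] over the polynomials in the central element [c]. Their
    independence comes only later, from the matrix representation. *)
Definition from_poly p q r s : A :=
  horner_alg c p + horner_alg c q * a + horner_alg c r * b
  + horner_alg c s * (a * b).

Lemma mul_a_from_poly p q r s : a * from_poly p q r s = from_poly q p s r.
Proof.
rewrite /from_poly !mulrDr !mulrA -!(comm_horner _ comm_ca).
rewrite -(mulrA _ a a) aa mulr1 -!mulrA (mulrA a a) aa mul1r.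
by rewrite addrAC (addrC (_ * a)).
Qed.

(** The relation [b * a = 2 c - a * b] restores the order of the letters; the terms in ['X *+ 2]
    come from its [2 c]. *)
Lemma mul_b_from_poly p q r s :
  b * from_poly p q r s =
  from_poly (q * 'X *+ 2 + r) (- s) (p + s * 'X *+ 2) (- q).
Proof.
have ba : b * a = c *+ 2 - a * b.
  by rewrite -scaler_nat scalerA divff // scale1r addrAC subrr add0r.
have h2 t : horner_alg c (t * 'X *+ 2) = horner_alg c t * (c *+ 2).
  by rewrite rmorphMn rmorphM /= horner_algX mulrnAr.
move: (c *+ 2) ba h2 => d ba h2.
rewrite /from_poly (rmorphD _ (q * _ *+ 2)) (rmorphD _ p) !rmorphN /= !h2.
rewrite !mulrDr !mulrA -!(comm_horner _ comm_cb) -!(mulrA _ b) bb mulr1 ba.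
rewrite -(mulrA _ (d - _)) mulrBl -(mulrA a b b) bb mulr1 !mulrBr mulrDl !mulNr.
by rewrite !mulrA !addrA [LHS](ACl (2*4*6*1*5*3)).
Qed.

Lemma from_polyD p q r s p' q' r' s' :
  from_poly p q r s + from_poly p' q' r' s' =
  from_poly (p + p') (q + q') (r + r') (s + s').
Proof.
by rewrite /from_poly !rmorphD /= !mulrDl !addrA [LHS](ACl (1*5*2*6*3*7*4*8)).
Qed.

Lemma from_polyZ k p q r s :
  k *: from_poly p q r s = from_poly (k *: p) (k *: q) (k *: r) (k *: s).
Proof.
have hZ t : horner_alg c (k *: t) = k *: horner_alg c t.
  by rewrite -mul_polyC rmorphM /= horner_algC mulr_algl.
by rewrite /from_poly !hZ !scalerDr !scalerAl.
Qed.

Lemma from_poly1 : from_poly 1 0 0 0 = 1.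
Proof. by rewrite /from_poly !rmorph0 rmorph1 !mul0r !addr0. Qed.

Definition poly_span (x : A) : Prop := exists p q r s, x = from_poly p q r s.

Lemma poly_spanD x y : poly_span x -> poly_span y -> poly_span (x + y).
Proof.
move=> [p [q [r [s ->]]]] [p' [q' [r' [s' ->]]]].
by do 4 eexists; apply: from_polyD.
Qed.

Lemma poly_span0 : poly_span 0.
Proof. by exists 0, 0, 0, 0; rewrite /from_poly rmorph0 !mul0r !addr0. Qed.

Lemma poly_spanZ k x : poly_span x -> poly_span (k *: x).
Proof. by move=> [p [q [r [s ->]]]]; do 4 eexists; apply: from_polyZ. Qed.

Lemma poly_span_word (w : seq bool) :
  poly_span (foldr (fun x y => (if x then a else b) * y) 1 w).
Proof.
elim: w => [|[] w [p [q [r [s e]]]]] /=.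
- by exists 1, 0, 0, 0; rewrite from_poly1.
- by exists q, p, s, r; rewrite e mul_a_from_poly.
- by do 4 eexists; rewrite e mul_b_from_poly.
Qed.

End TwoInvolutions.

(** * Classification of primitive idempotents through a faithful representation *)

Section FaithfulRepresentation.
Variables (F : fieldType) (A : algType F) (a b : A).
Variable to_mx : {rmorphism A -> 'M[{poly F}]_2}.
Implicit Types x y : A.
Hypotheses (two_neq0 : 2%:R != 0 :> F) (aa : a * a = 1) (bb : b * b = 1).
Hypothesis to_mxZ : forall k x, to_mx (k *: x) = k%:P *: to_mx x.
Hypothesis to_mx_a : to_mx a = mx2 1 0 0 (-1).
Hypothesis to_mx_b : to_mx b = mx2 'X (1 - 'X) (1 + 'X) (- 'X).
Hypothesis spanned_by_ab : forall x, poly_span a b x.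
Local Notation c := (half_sum a b).

Lemma half_two_polyK (p : {poly F}) : 2^-1%:P * 2 * p = p.
Proof. by rewrite -polyC_natr -polyCM mulVf // mul1r. Qed.

Lemma to_mx_c : to_mx c = 'X%:M.
Proof.
rewrite to_mxZ rmorphD !rmorphM /= to_mx_a to_mx_b !mx2M mx2D mx2Z.
rewrite mx2_scalar; congr mx2; try ring.
- by transitivity ((2^-1 : F)%:P * 2 * 'X);
    [ring | rewrite half_two_polyK; ring].
- by transitivity ((2^-1 : F)%:P * 2 * 'X);
    [ring | rewrite half_two_polyK; ring].
Qed.

Lemma to_mx_horner p : to_mx (horner_alg c p) = p%:M.
Proof.
elim/poly_ind: p => [|p k IHp]; first by rewrite !rmorph0.
rewrite !rmorphD !rmorphM /= IHp horner_algX horner_algC to_mx_c.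
rewrite to_mxZ rmorph1 !mx2_scalar mx2_1 mx2Z mx2M !mx2D.
by congr mx2; ring.
Qed.

Lemma to_mx_from_poly p q r s :
  to_mx (from_poly a b p q r s) =
  mx2 (p + q + 'X * (r + s)) ((1 - 'X) * (r + s))
      ((1 + 'X) * (r - s)) (p - q - 'X * (r - s)).
Proof.
rewrite /from_poly !rmorphD !rmorphM /= !to_mx_horner to_mx_a to_mx_b.
rewrite !mx2_scalar !(mx2M, mx2D).
by congr mx2; ring.
Qed.

Lemma poly_double_eq0 (p : {poly F}) : p + p = 0 -> p = 0.
Proof.
move=> pp; rewrite -[p]half_two_polyK.
by transitivity ((2^-1 : F)%:P * (p + p)); [ring | rewrite pp mulr0].
Qed.

(** The coordinates of an element can be read off its matrix: cancelling [1 - 'X] and [1 + 'X] off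
    the diagonal gives [r + s] and [r - s], the diagonal then gives [p + q] and [p - q], and 2 is
    invertible. *)
Lemma to_mx_inj : injective to_mx.
Proof.
move=> x y /eqP; rewrite -subr_eq0 -rmorphB => /eqP e.
apply/eqP; rewrite -subr_eq0; apply/eqP.
have [p [q [r [s exy]]]] := spanned_by_ab (x - y).
move: e; rewrite exy to_mx_from_poly mx2_0 => /mx2_inj[e1 e2 e3 e4].
have nz1 : 1 - 'X != 0 :> {poly F}.
  by rewrite -opprB oppr_eq0 -polyC1 polyXsubC_eq0.
have nz2 : 1 + 'X != 0 :> {poly F}.
  by rewrite addrC -[1]opprK -polyC1 -polyCN polyXsubC_eq0.
have {}e2 : r + s = 0 by apply: (mulfI nz1); rewrite e2 mulr0.
have {}e3 : r - s = 0 by apply: (mulfI nz2); rewrite e3 mulr0.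
rewrite e2 e3 mulr0 addr0 subr0 in e1 e4.
have sumdiff (t u : {poly F}) : t + u = 0 -> t - u = 0 -> t = 0 /\ u = 0.
  move=> tu tu'; have t0 : t = 0.
    apply: poly_double_eq0; transitivity (t + u + (t - u)); first ring.
    by rewrite tu tu' addr0.
  by split=> //; move: tu; rewrite t0 add0r.
have [-> ->] := sumdiff _ _ e1 e4; have [-> ->] := sumdiff _ _ e2 e3.
by rewrite /from_poly rmorph0 !mul0r !addr0.
Qed.

Lemma to_mx_order x : in_order (to_mx x).
Proof.
have [p [q [r [s ->]]]] := spanned_by_ab x.
rewrite to_mx_from_poly /in_order !mxE /= !hornerE.
by rewrite subrr !mul0r.
Qed.

Lemma to_mx_onto M : in_order M -> exists x, to_mx x = M.
Proof.
case=> /eqP/factor_theorem[u eu] /eqP/factor_theorem[w ew].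
(* These solve the equations of [to_mx_from_poly]: the off-diagonal entries [u * ('X - 1)] and
   [w * ('X + 1)] force [r + s = - u] and [r - s = w], and the diagonal then determines [p + q] and
   [p - q]. *)
exists (from_poly a b (2^-1 *: (M 0 0 + M 1 1 + 'X * (w + u)))
  (2^-1 *: (M 0 0 - M 1 1 - 'X * (w - u)))
  (2^-1 *: (w - u)) (2^-1 *: (- u - w))).
rewrite to_mx_from_poly [RHS]mx2E eu ew polyC1 polyCN.
rewrite -!mul_polyC; congr mx2.
- by transitivity ((2^-1 : F)%:P * 2 * (M 0 0));
    [ring | exact: half_two_polyK].
- by transitivity ((2^-1 : F)%:P * 2 * (u * ('X - 1)));
    [ring | exact: half_two_polyK].
- by transitivity ((2^-1 : F)%:P * 2 * (w * ('X - - 1)));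
    [ring | exact: half_two_polyK].
- by transitivity ((2^-1 : F)%:P * 2 * (M 1 1));
    [ring | exact: half_two_polyK].
Qed.

Definition trace x : {poly F} := to_mx x 0 0 + to_mx x 1 1.

(** The invariant that separates the conjugacy classes. *)
Definition corner x : F * F := ((to_mx x 0 0).[1], (to_mx x 0 0).[-1]).

Lemma traceD x y : trace (x + y) = trace x + trace y.
Proof. by rewrite /trace rmorphD !mxE addrACA. Qed.

Lemma to_mx_idem x : is_idempotent x -> is_idempotent (to_mx x).
Proof. by rewrite /is_idempotent -rmorphM => ->. Qed.

Lemma idem_trace x :
  is_idempotent x -> [\/ x = 0, x = 1 | trace x = 1].
Proof.
move=> /to_mx_idem; rewrite (mx2E (to_mx x)) => /mx2_idem.
rewrite -mx2E => -[e|e|e]; last by constructor 3.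
- by constructor 1; apply: to_mx_inj; rewrite e rmorph0.
- by constructor 2; apply: to_mx_inj; rewrite e rmorph1.
Qed.

(** In an orthogonal splitting into nonzero idempotents neither summand is 1, so each has trace 1
    and the sum would have trace [1 + 1]. *)
Lemma trace1_primitive x :
  is_idempotent x -> trace x = 1 -> primitive_idempotent x.
Proof.
move=> ix tx; split=> //.
  apply/eqP=> x0; move: tx; rewrite x0 /trace rmorph0 !mxE addr0.
  by move/esym/eqP; rewrite oner_eq0.
case=> x1 [x2 [[i1 i2] [/eqP n1 /eqP n2] ex o1 o2]].
case: (idem_trace i1) => [//|e1|t1]; first by apply: n2; rewrite -o1 e1 mul1r.
case: (idem_trace i2) => [//|e2|t2]; first by apply: n1; rewrite -o1 e2 mulr1.
move: tx; rewrite ex traceD t1 t2 => /eqP.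
by rewrite -subr_eq0 addrK oner_eq0.
Qed.

(** The point is to exclude [x = 1]: the given [y] of trace 1 is neither 0 nor 1, so
    [1 = y + (1 - y)] is a proper splitting. *)
Lemma primitive_trace1 x y :
    is_idempotent y -> trace y = 1 -> primitive_idempotent x ->
  trace x = 1.
Proof.
move=> iy ty [ix nx irr]; case: (idem_trace ix) => // [x0|x1].
  by rewrite x0 eqxx in nx.
have tr1 : trace 1 = 1 + 1 by rewrite /trace rmorph1 !mxE.
case: irr; exists y, (1 - y); rewrite x1; split=> //.
- by split=> //; apply: compl_idem.
- split; last rewrite subr_eq0; apply/eqP => e; move/eqP: ty.
    by rewrite e /trace rmorph0 !mxE addr0 eq_sym oner_eq0.
  by rewrite -e tr1 -subr_eq0 addrK oner_eq0.
- by rewrite addrC subrK.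
- by rewrite mulrBr mulr1 iy subrr.
- by rewrite mulrBl mul1r iy subrr.
Qed.

Lemma corner_conj x y : conjugate x y -> corner x = corner y.
Proof.
case=> P [Q [PQ QP ->]].
have o := to_mx_order.
have PQ1 : to_mx P * to_mx Q = 1 by rewrite -rmorphM PQ rmorph1.
have [e1 e2] := in_order_conj_diag (o P) (o Q) (o x) PQ1 erefl.
by rewrite /corner !rmorphM /= e1 e2.
Qed.

(** The conjugating matrices lie in the order, hence lift to the algebra by [to_mx_onto];
    injectivity lifts the identities between them. *)
Lemma conj_corner x y :
    is_idempotent x -> trace x = 1 -> is_idempotent y -> trace y = 1 ->
  corner x = corner y -> conjugate x y.
Proof.
move=> /to_mx_idem ix tx /to_mx_idem iy ty [c1 c2].
have o := to_mx_order.
have [P [Q [[oP oQ] PQ QP e]]] := rank1_conj ix tx (o x) iy ty (o y) c1 c2.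
have [nu eP] := to_mx_onto oP; have [nu' eQ] := to_mx_onto oQ.
exists nu, nu'; split; apply: to_mx_inj.
- by rewrite rmorphM rmorph1 /= eP eQ.
- by rewrite rmorphM rmorph1 /= eP eQ.
- by rewrite !rmorphM /= eP eQ.
Qed.

(** Multiplicativity at 1 and at -1 makes both components idempotents of the field. *)
Lemma corner_values x : is_idempotent x ->
  corner x \in [:: (0, 0); (1, 1); (0, 1); (1, 0)].
Proof.
move=> /to_mx_idem; have := to_mx_order x.
rewrite /corner /in_order (mx2E (to_mx x)) !mxE /= => -[h1 h2].
rewrite /is_idempotent mx2M => /mx2_inj[e _ _ _].
have v1 : (to_mx x 0 0).[1] = 0 \/ (to_mx x 0 0).[1] = 1.
  apply: idempotent_01; have := congr1 (horner^~ 1) e.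
  by rewrite /= !hornerE h1 mul0r addr0.
have v2 : (to_mx x 0 0).[-1] = 0 \/ (to_mx x 0 0).[-1] = 1.
  apply: idempotent_01; have := congr1 (horner^~ (-1)) e.
  by rewrite /= !hornerE h2 mulr0 addr0.
by case: v1 => ->; case: v2 => ->; rewrite !inE eqxx ?orbT.
Qed.

Lemma half_involution (s : A) :
  s * s = 1 -> is_idempotent (2^-1 *: (1 - s)).
Proof.
move=> ss; rewrite /is_idempotent -scalerAl -scalerAr scalerA.
have -> : (1 - s) * (1 - s) = 2 *: (1 - s).
  rewrite mulrBr mulrBl mulr1 mul1r mulrBl mul1r ss opprB.
  by rewrite scaler_nat mulr2n.
by rewrite scalerA -mulrA mulVf ?mulr1.
Qed.

Local Notation e := (2^-1 *: (1 - a)).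
Local Notation e' := (2^-1 *: (1 - b)).

Lemma trace_compl x : trace x = 1 -> trace (1 - x) = 1.
Proof.
move=> tx; apply: (addIr (trace x)); rewrite -traceD subrK tx.
by rewrite /trace rmorph1 !mxE.
Qed.

Lemma corner_compl x : corner (1 - x) = (1 - (corner x).1, 1 - (corner x).2).
Proof. by rewrite /corner rmorphB rmorph1 !mxE !hornerE. Qed.

Lemma to_mx_half x :
  to_mx (2^-1 *: (1 - x)) = 2^-1%:P *: (1 - to_mx x).
Proof. by rewrite to_mxZ rmorphB rmorph1. Qed.

Lemma trace_e : trace e = 1.
Proof.
rewrite /trace to_mx_half to_mx_a !mxE /=.
by transitivity ((2^-1 : F)%:P * 2 * 1 : {poly F});
    [ring | exact: half_two_polyK].
Qed.

Lemma trace_e' : trace e' = 1.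
Proof.
rewrite /trace to_mx_half to_mx_b !mxE /=.
by transitivity ((2^-1 : F)%:P * 2 * 1 : {poly F});
    [ring | exact: half_two_polyK].
Qed.

Lemma corner_e : corner e = (0, 0).
Proof. by rewrite /corner to_mx_half to_mx_a !mxE /= subrr mulr0 !hornerE. Qed.

Lemma corner_e' : corner e' = (0, 1).
Proof.
rewrite /corner to_mx_half to_mx_b !mxE /= !hornerE.
by rewrite subrr mulr0 opprK mulVf.
Qed.

Lemma representatives :
  let rep : 'I_4 -> A := tnth [tuple e; 1 - e; e'; 1 - e'] in
  [/\ forall i, is_idempotent (rep i), forall i, trace (rep i) = 1 &
      forall i, corner (rep i) =
        tnth [tuple (0, 0); (1, 1); (0, 1); (1, 0)] i].
Proof.
have ie : is_idempotent e by apply/half_involution/aa.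
have ie' : is_idempotent e' by apply/half_involution/bb.
move=> rep; have ord4 (P : 'I_4 -> Prop) :
    P (inord 0) -> P (inord 1) -> P (inord 2) -> P (inord 3) -> forall i, P i.
  move=> P0 P1 P2 P3 i; rewrite -[i]inord_val.
  by case: i => [[|[|[|[|]]]]].
split; apply: ord4; rewrite /rep !(tnth_nth 0) !inordK //=.
- exact: compl_idem.
- exact: compl_idem.
- exact: trace_e.
- exact/trace_compl/trace_e.
- exact: trace_e'.
- exact/trace_compl/trace_e'.
- exact: corner_e.
- by rewrite corner_compl corner_e subr0.
- exact: corner_e'.
- by rewrite corner_compl corner_e' subr0 subrr.
Qed.

(** On idempotents of trace 1 [corner] is a complete conjugacy invariant, and the representatives
    take each of its four possible values exactly once. *)
Theorem four_conjugacy_classes :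
  let rep : 'I_4 -> A := tnth [tuple e; 1 - e; e'; 1 - e'] in
  [/\ forall i : 'I_4, primitive_idempotent (rep i),
      forall i j : 'I_4, conjugate (rep i) (rep j) -> i = j &
      forall x : A, primitive_idempotent x ->
        exists i : 'I_4, conjugate (rep i) x].
Proof.
move=> rep; have [irep trep crep] := representatives.
split=> [i|i j|x px].
- exact: trace1_primitive.
- move=> /corner_conj; rewrite !crep => /eqP.
  rewrite !(tnth_nth 0) nth_uniq ?size_tuple // => [/eqP/val_inj //|].
  by rewrite /= !inE !xpair_eqE !eqxx [0 == 1]eq_sym oner_eq0.
- have tx := primitive_trace1 (irep 0) (trep 0) px.
  have ix : is_idempotent x by case: px.
  have /tnthP[i ci] : corner x \in [tuple (0, 0); (1, 1); (0, 1); (1, 0)].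
    exact: corner_values.
  exists i; apply: conj_corner (irep i) (trep i) ix tx _.
  by rewrite crep ci.
Qed.

End FaithfulRepresentation.

(** * The matrix representation of the infinite dihedral group *)

Section DihedralRepresentation.
Variable F : fieldType.
Local Notation R := (group_algebra F Dinf).
Local Notation M2 := 'M[{poly F}]_2.

Definition gen_mx (x : bool) : M2 :=
  if x then mx2 1 0 0 (-1) else mx2 'X (1 - 'X) (1 + 'X) (- 'X).

Lemma gen_mxK x : gen_mx x * gen_mx x = 1.
Proof. by case: x; rewrite mx2M mx2_1; congr mx2; ring. Qed.

Definition word_mx (w : seq bool) : M2 :=
  foldr (fun x M => gen_mx x * M) 1 w.

(** The cancelling branch of [cons_red] is harmless because [gen_mx x] squares to 1; hence [word_mx]
    respects the product of normal forms. *)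
Lemma word_mx_cons_red x w : word_mx (cons_red x w) = gen_mx x * word_mx w.
Proof.
case: w => [|y w] //=; case: eqVneq => //= <-.
by rewrite mulrA gen_mxK mul1r.
Qed.

Lemma word_mxM (g h : Dinf) :
  word_mx (g * h)%g = word_mx g * word_mx h.
Proof.
rewrite /=; elim: (word g) => [|x w IHw]; first by rewrite mul1r.
by rewrite [mul_word _ _]/= word_mx_cons_red IHw mulrA.
Qed.

Definition Dinf_mx : R -> M2 :=
  galg_lift (@polyC F) (fun g : Dinf => word_mx g).

Lemma Dinf_mx_is_additive : zmod_morphism Dinf_mx.
Proof.
move=> x y; rewrite -scaleN1r /Dinf_mx galg_liftD galg_liftZ.
by rewrite rmorphN1 scaleN1r.
Qed.

Lemma Dinf_mx_is_multiplicative : monoid_morphism Dinf_mx.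
Proof.
split; first exact: galg_lift1.
by move=> x y; apply: galg_liftM => // g h; rewrite word_mxM.
Qed.

HB.instance Definition _ :=
  GRing.isZmodMorphism.Build R M2 Dinf_mx Dinf_mx_is_additive.
HB.instance Definition _ :=
  GRing.isMonoidMorphism.Build R M2 Dinf_mx Dinf_mx_is_multiplicative.

Lemma Dinf_mxZ c x : Dinf_mx (c *: x) = c%:P *: Dinf_mx x.
Proof. exact: galg_liftZ. Qed.

Let a : R := galg_elt F Da.
Let b : R := galg_elt F Db.

Lemma Dinf_mx_a : Dinf_mx a = mx2 1 0 0 (-1).
Proof. by rewrite [Dinf_mx a]galg_liftU rmorph1 scale1r /= mulr1. Qed.

Lemma Dinf_mx_b : Dinf_mx b = mx2 'X (1 - 'X) (1 + 'X) (- 'X).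
Proof. by rewrite [Dinf_mx b]galg_liftU rmorph1 scale1r /= mulr1. Qed.

Lemma Da_sq : a * a = 1.
Proof. by rewrite -galg_eltM; congr galg_elt; exact/val_inj. Qed.

Lemma Db_sq : b * b = 1.
Proof. by rewrite -galg_eltM; congr galg_elt; exact/val_inj. Qed.

Hypothesis two_neq0 : 2%:R != 0 :> F.

Lemma galg_elt_word (g : Dinf) :
  galg_elt F g = foldr (fun x y => (if x then a else b) * y) 1 (word g).
Proof.
case: g => w; elim: w => [|x w IHw] rw.
  by rewrite /= -galg_elt1; congr galg_elt; apply/val_inj.
have rw' : reduced w by apply: path_sorted rw.
(* In a reduced word, putting the first letter back in front cancels nothing. *)
have eg : MkDinf rw = ((if x then Da else Db) * MkDinf rw')%g.
  apply/val_inj; rewrite /=; case: x rw => /=;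
    by case: (w) => [|y w'] //= /andP[/negbTE->].
rewrite [LHS](congr1 (galg_elt F) eg) galg_eltM (IHw rw') [RHS]/=.
by case: x {rw eg}.
Qed.

Lemma poly_span_Dinf (x : R) : poly_span a b x.
Proof.
elim/galg_ind: x => [|x y sx sy|k g].
- exact: poly_span0.
- exact: poly_spanD.
rewrite -[k]mulr1 -galg_scaleU -/(galg_elt F g) galg_elt_word.
by apply: poly_spanZ; apply: (poly_span_word two_neq0 Da_sq Db_sq).
Qed.

End DihedralRepresentation.

Theorem corollary3 (K : closedFieldType) (charK : 2%N \notin [pchar K]) :
  let R : algType K := group_algebra K Dinf in
  let e : R := 2%:R^-1 *: (1 - galg_elt K Da) in
  let e' : R := 2%:R^-1 *: (1 - galg_elt K Db) in
  let rep : 'I_4 -> R := tnth [tuple e; 1 - e; e'; 1 - e'] in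
  [/\ forall i : 'I_4, primitive_idempotent (rep i),
      forall i j : 'I_4, conjugate (rep i) (rep j) -> i = j &
      forall x : R, primitive_idempotent x ->
        exists i : 'I_4, conjugate (rep i) x].
Proof.
have two_neq0 : 2%:R != 0 :> K by move: charK; rewrite inE.
exact: (four_conjugacy_classes two_neq0 (Da_sq K) (Db_sq K) (@Dinf_mxZ K)
          (Dinf_mx_a K) (Dinf_mx_b K) (poly_span_Dinf two_neq0)).
Qed.
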